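(* Let $A$ be a commutative ring, $k\ge1$, and $\vec s=(n_1,\dots,n_k)$ a tuple of positive integers. For every $p\ge-1$ and every $\sigma\in\operatorname{Stab}(\vec s)$, the shift-and-truncate homotopy $H_p:X_p\to X_{p+1}$ on the diagonal simplicial tensor module $X_\bullet=X_\bullet(\vec s;A)$ is equivariant: $$H_p(\sigma\cdot T)=\sigma\cdot H_p(T)\qquad\text{for all }T\in X_p.$$
   Context: Notation: $[p]=\{0,\dots,p\}$. For a shape $\vec s=(n_1,\dots,n_k)$ put $n=\min(n_1,\dots,n_k)-1$, $M_a(p)=n_a-1-n+p$ (so $M_a(p)\ge p$), $I_p=\prod_{a=1}^k[M_a(p)]$ for $p\ge 0$, and $X_p=X_p(\vec s;A)=A^{I_p}$ (all functions $T:I_p\to A$); $X_p=0$ for $p<0$. $\operatorname{Stab}(\vec s)=\{\sigma\in S_k: n_{\sigma(a)}=n_a\text{ for all }a\}$ acts on $I_p$ by $\sigma\cdot(m_1,\dots,m_k)=(m_{\sigma^{-1}(1)},\dots,m_{\sigma^{-1}(k)})$ and on $X_p$ by $(\sigma\cdot T)(m)=T(\sigma^{-1}\cdot m)$. The shift-and-truncate homotopy $H_p:X_p\to X_{p+1}$ is defined by $H_{-1}=0$ and, for $p\ge0$, $T\in X_p$, $m\in I_{p+1}$: $H_p(T)(m)=0$ if some $m_a=0$, and $H_p(T)(m)=T(m-\vec 1)$ if $m_a>0$ for all $a$, where $\vec1=(1,\dots,1)$. *)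

(* Defs.v *)
From HB Require Import structures.
From mathcomp Require Import all_boot all_order all_algebra all_fingroup.

Set Implicit Arguments.
Unset Strict Implicit.
Unset Printing Implicit Defensive.

Import GRing.Theory.
Local Open Scope ring_scope.

Section Shape.

Variables (k : nat) (s : k.-tuple nat).

(* For k > 0 the starting value is an entry of s, so that this is the minimum
   of the entries. *)
Definition min_shape : nat := \big[minn/head 0%N s]_(x <- s) x.

Definition sdim : nat := (min_shape - 1)%N.

(* The subtractions do not truncate when k > 0 and the entries are positive. *)
Definition top (p : nat) (a : 'I_k) : nat := (tnth s a - 1 - sdim + p)%N.

(* 'I_(top p a).+1 is {0, ..., top p a}. *)
Definition idx (p : nat) := {dffun forall a : 'I_k, 'I_(top p a).+1}.

Definition Stab : {set 'S_k} :=
  [set sigma : 'S_k | [forall a, tnth s (sigma a) == tnth s a]].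

Lemma StabP (sigma : 'S_k) :
  reflect (forall a, tnth s (sigma a) = tnth s a) (sigma \in Stab).
Proof. by rewrite inE; apply: (iffP forallP) => h a; apply/eqP/h. Qed.

Lemma Stab_group_set : group_set Stab.
Proof.
apply/group_setP; split; first by apply/StabP => a; rewrite perm1.
by move=> x y /StabP hx /StabP hy; apply/StabP => a; rewrite permM hy hx.
Qed.

Canonical Stab_group := Group Stab_group_set.

Lemma StabV (sigma : 'S_k) : sigma \in Stab -> (sigma^-1)%g \in Stab.
Proof. exact: groupVr. Qed.

Lemma top_Stab (sigma : 'S_k) (hsigma : sigma \in Stab) (p : nat) (a : 'I_k) :
  (top p ((sigma^-1)%g a)).+1 = (top p a).+1.
Proof. by rewrite /top (StabP _ (StabV hsigma)). Qed.

(* The cast leaves the underlying natural number unchanged; it only identifies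
   the equal bounds at sigma^-1 a and at a. *)
Definition act_idx (sigma : 'S_k) (hsigma : sigma \in Stab) (p : nat)
    (m : idx p) : idx p :=
  [ffun a => cast_ord (top_Stab hsigma p a) (m ((sigma^-1)%g a))].

Lemma pred_idx_subproof (p : nat) (m : idx (p + 1)) (a : 'I_k) :
  ((m a).-1 < (top p a).+1)%N.
Proof.
have := ltn_ord (m a); case: (nat_of_ord _) => [|j] //=.
by rewrite /top addnA addn1 !ltnS.
Qed.

(* m - (1, ..., 1), meaningful only when all the m a are positive. *)
Definition pred_idx (p : nat) (m : idx (p + 1)) : idx p :=
  [ffun a => Ordinal (pred_idx_subproof m a)].

Variable A : comPzRingType.

Definition X (p : int) : lmodType A :=
  match p with
  | Posz q => {ffun idx q -> A^o}
  | Negz _ => {ffun void -> A^o}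
  end.

Definition act_X (sigma : 'S_k) (hsigma : sigma \in Stab) (p : int) :
    X p -> X p :=
  match p return X p -> X p with
  | Posz q => fun T : {ffun idx q -> A^o} =>
      [ffun m => T (act_idx (StabV hsigma) m)]
  | Negz _ => fun T => T
  end.

Definition H (p : int) : X p -> X (p + 1) :=
  match p return X p -> X (p + 1) with
  | Posz q => fun T : {ffun idx q -> A^o} =>
      [ffun m : idx (q + 1) =>
         if [exists a, m a == 0%N :> nat] then 0 else T (pred_idx m)]
  | Negz _ => fun _ => 0
  end.

End Shape.

Arguments act_X {k s A sigma} hsigma {p} T.
Arguments H {k s A} p T.

(* Main.v *)
Require Import Defs.
From HB Require Import structures.
From mathcomp Require Import all_boot all_order all_algebra all_fingroup.

Set Implicit Arguments.
Unset Strict Implicit.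
Unset Printing Implicit Defensive.

Import GRing.Theory.
Local Open Scope ring_scope.

(** Both ingredients of [H] are symmetric in the coordinates. The shift vector (1, ..., 1) is fixed
    by every permutation, so the shift commutes with the action ([act_idx_pred]), and whether some
    coordinate vanishes does not depend on their order ([act_idx_has_zero]). Evaluated at an index,
    the two sides therefore take the same branch with the same value. *)

Lemma act_idx_val (k : nat) (s : k.-tuple nat) (sigma : 'S_k)
    (hsigma : sigma \in Stab s) (q : nat) (m : idx s q) (a : 'I_k) :
  act_idx hsigma m a = m ((sigma^-1)%g a) :> nat.
Proof. by rewrite ffunE. Qed.

Lemma pred_idx_val (k : nat) (s : k.-tuple nat) (q : nat) (m : idx s (q + 1))
    (a : 'I_k) :
  pred_idx m a = (m a).-1 :> nat.
Proof. by rewrite ffunE. Qed.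

(** Comparing underlying naturals removes the casts between equal bounds and leaves the same
    predecessor on both sides. *)
Lemma act_idx_pred (k : nat) (s : k.-tuple nat) (sigma : 'S_k)
    (hsigma : sigma \in Stab s) (q : nat) (m : idx s (q + 1)) :
  act_idx hsigma (pred_idx m) = pred_idx (act_idx hsigma m).
Proof.
apply/ffunP => a; apply: val_inj => /=.
by rewrite act_idx_val !pred_idx_val act_idx_val.
Qed.

Lemma act_idx_has_zero (k : nat) (s : k.-tuple nat) (sigma : 'S_k)
    (hsigma : sigma \in Stab s) (q : nat) (m : idx s q) :
  [exists a, act_idx hsigma m a == 0%N :> nat] =
  [exists a, m a == 0%N :> nat].
Proof.
apply/existsP/existsP => -[a ha].
  by exists ((sigma^-1)%g a); rewrite -(act_idx_val hsigma).
(* The action reads coordinate [a] of [m] at position [sigma a]. *)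
by exists (sigma a); rewrite act_idx_val permK.
Qed.

Theorem mainTheorem6 (A : comPzRingType) (k : nat) (hk : (0 < k)%N)
    (s : k.-tuple nat) (hs : forall a : 'I_k, (0 < tnth s a)%N)
    (p : int) (hp : -1 <= p)
    (sigma : 'S_k) (hsigma : sigma \in Stab s) (T : X s A p) :
  H p (act_X hsigma T) = act_X hsigma (H p T).
Proof.
(* [Negz 0] is p = -1, where both sides are the zero function on [idx s 0]; [Negz n.+1] contradicts
   [hp]. *)
case: p hp T => [q|[|n]] // _ T; apply/ffunP => m; rewrite !ffunE //.
by rewrite act_idx_has_zero act_idx_pred.
Qed.
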